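(* Let $H_i$ ($i\in\mathbb{N}$) and $H$ be continuous functions $[0,T]\times\mathbb{R}^n\times\mathbb{R}^n\to\mathbb{R}$, each satisfying (H1)–(H4) and (HLC). Let $(\mathbb{R}^{n+1},f_i,l_i)$ and $(\mathbb{R}^{n+1},f,l)$ be the Steiner representations of $H_i$ and $H$, respectively (as defined in the context). If $H_i$ converge to $H$ uniformly on compact subsets of $[0,T]\times\mathbb{R}^n\times\mathbb{R}^n$, then $f_i\to f$ and $l_i\to l$ uniformly on compact subsets of $[0,T]\times\mathbb{R}^n\times\mathbb{R}^{n+1}$.
   Context: Hypotheses on a function $H:[0,T]\times\mathbb{R}^n\times\mathbb{R}^n\to\mathbb{R}$: (H1) $H(\cdot,x,p)$ Lebesgue measurable; (H2) $H(t,\cdot,\cdot)$ continuous; (H3) $H(t,x,\cdot)$ convex; (H4) there is a measurable $c\ge0$ with $|H(t,x,p)-H(t,x,q)|\le c(t)(1+|x|)|p-q|$; (HLC) for every $R>0$ there is a measurable $k_R\ge0$ with $|H(t,x,p)-H(t,y,p)|\le k_R(t)(1+|p|)|x-y|$ for $x,y$ in the closed ball $\bar B_R$ of radius $R$ about $0$ and all $p$. $H^*(t,x,v)=\sup_p\{\langle v,p\rangle-H(t,x,p)\}$. Steiner representation of $H$: for $(t,x)$ let $E(t,x)=\mathrm{epi}\,H^*(t,x,\cdot)=\{(v,\eta)\in\mathbb{R}^n\times\mathbb{R}:H^*(t,x,v)\le\eta\}$ (a nonempty closed convex set). For $a\in\mathbb{R}^{n+1}$ put $\Phi(t,x,a)=E(t,x)\cap\bar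 B(a,2d(a,E(t,x)))$, where $d(a,K)=\inf_{\xi\in K}|a-\xi|$ and $\bar B(a,r)$ is the closed ball. For a nonempty compact convex $K\subset\mathbb{R}^m$ its Steiner point is $s_m(K)=m\int_{S^{m-1}}p\,\sigma(K,p)\,\mu(dp)$, with $\sigma(K,p)=\max_{y\in K}\langle p,y\rangle$ and $\mu$ the rotation-invariant probability measure on the unit sphere $S^{m-1}$. Set $e(t,x,a)=s_{n+1}(\Phi(t,x,a))$ and write $e(t,x,a)=(f(t,x,a),l(t,x,a))$ with $f\in\mathbb{R}^n$, $l\in\mathbb{R}$. *)

(* Defs.v *)
From HB Require Import structures.
From mathcomp Require Import all_boot all_order all_algebra.
From mathcomp Require Import all_classical all_reals all_analysis.

Set Implicit Arguments.
Unset Strict Implicit.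
Unset Printing Implicit Defensive.

Import Order.TTheory GRing.Theory Num.Theory.
Import numFieldNormedType.Exports.
Local Open Scope classical_set_scope.
Local Open Scope ring_scope.

Section Defs.
Variable R : realType.

Definition dotv (m : nat) (u v : 'rV[R]_m) : R := \sum_(j < m) u ord0 j * v ord0 j.
Definition enorm (m : nat) (v : 'rV[R]_m) : R := Num.sqrt (dotv v v).

Definition cball (m : nat) (a : 'rV[R]_m) (r : R) : set 'rV[R]_m :=
  [set y | enorm (a - y) <= r].
Definition edist (m : nat) (a : 'rV[R]_m) (K : set 'rV[R]_m) : R :=
  inf [set enorm (a - y) | y in K].

Definition supportf (m : nat) (K : set 'rV[R]_m) (p : 'rV[R]_m) : R :=
  sup [set dotv p y | y in K].

(** Lebesgue integral over R^m, as the iterated one-dimensional Lebesgue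
    integral (Fubini); the first coordinate is integrated outermost. *)
Fixpoint iint (m : nat) : ('rV[R]_m -> R) -> R :=
  match m return ('rV[R]_m -> R) -> R with
  | 0 => fun g => g 0
  | m'.+1 => fun g =>
      Rintegral lebesgue_measure setT
        (fun r : R => iint (fun y : 'rV[R]_m' => g (row_mx (const_mx r : 'rV[R]_1) y)))
  end.

(** Integral of phi over the unit sphere S^{m-1} with respect to the
    rotation-invariant probability measure mu, realised as the image of the
    normalised Lebesgue measure on the closed unit ball under x |-> x/|x|. *)
Definition sphere_int (m : nat) (phi : 'rV[R]_m -> R) : R :=
  iint (fun x : 'rV[R]_m => if enorm x <= 1 then phi ((enorm x)^-1 *: x) else 0)
  / iint (fun x : 'rV[R]_m => if enorm x <= 1 then 1 else 0).

Definition steiner_point (m : nat) (K : set 'rV[R]_m) : 'rV[R]_m :=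
  \row_(j < m) (m%:R * sphere_int (fun p : 'rV[R]_m => p ord0 j * supportf K p)).

Definition Hconj (n : nat) (H : R -> 'rV[R]_n -> 'rV[R]_n -> R)
    (t : R) (x v : 'rV[R]_n) : \bar R :=
  ereal_sup [set ((dotv v p - H t x p)%:E) | p in [set: 'rV[R]_n]].

Definition vpart (n : nat) (a : 'rV[R]_(n + 1)) : 'rV[R]_n := lsubmx a.
Definition etapart (n : nat) (a : 'rV[R]_(n + 1)) : R := rsubmx a ord0 ord0.

Definition epiHconj (n : nat) (H : R -> 'rV[R]_n -> 'rV[R]_n -> R)
    (t : R) (x : 'rV[R]_n) : set 'rV[R]_(n + 1) :=
  [set a | (Hconj H t x (vpart a) <= (etapart a)%:E)%E].

Definition PhiSet (n : nat) (H : R -> 'rV[R]_n -> 'rV[R]_n -> R)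
    (t : R) (x : 'rV[R]_n) (a : 'rV[R]_(n + 1)) : set 'rV[R]_(n + 1) :=
  epiHconj H t x `&` cball a (2 * edist a (epiHconj H t x)).

Definition steiner_e (n : nat) (H : R -> 'rV[R]_n -> 'rV[R]_n -> R)
    (t : R) (x : 'rV[R]_n) (a : 'rV[R]_(n + 1)) : 'rV[R]_(n + 1) :=
  steiner_point (PhiSet H t x a).
Definition steiner_f (n : nat) (H : R -> 'rV[R]_n -> 'rV[R]_n -> R)
    (t : R) (x : 'rV[R]_n) (a : 'rV[R]_(n + 1)) : 'rV[R]_n :=
  vpart (steiner_e H t x a).
Definition steiner_l (n : nat) (H : R -> 'rV[R]_n -> 'rV[R]_n -> R)
    (t : R) (x : 'rV[R]_n) (a : 'rV[R]_(n + 1)) : R :=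
  etapart (steiner_e H t x a).

Definition H_continuous (n : nat) (T : R) (H : R -> 'rV[R]_n -> 'rV[R]_n -> R) : Prop :=
  {within [set q : R * ('rV[R]_n * 'rV[R]_n) | q.1 \in `[0, T]],
     continuous (fun q : R * ('rV[R]_n * 'rV[R]_n) => H q.1 q.2.1 q.2.2)}.

Definition H1 (n : nat) (T : R) (H : R -> 'rV[R]_n -> 'rV[R]_n -> R) : Prop :=
  forall x p : 'rV[R]_n, measurable_fun `[0, T] (fun t => H t x p).

Definition H2 (n : nat) (T : R) (H : R -> 'rV[R]_n -> 'rV[R]_n -> R) : Prop :=
  forall t, t \in `[0, T] ->
    continuous (fun xp : 'rV[R]_n * 'rV[R]_n => H t xp.1 xp.2).

Definition H3 (n : nat) (T : R) (H : R -> 'rV[R]_n -> 'rV[R]_n -> R) : Prop :=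
  forall t, t \in `[0, T] -> forall (x p q : 'rV[R]_n) (lam : R), 0 <= lam <= 1 ->
    H t x (lam *: p + (1 - lam) *: q) <= lam * H t x p + (1 - lam) * H t x q.

Definition H4 (n : nat) (T : R) (H : R -> 'rV[R]_n -> 'rV[R]_n -> R) : Prop :=
  exists c : R -> R, measurable_fun `[0, T] c /\
    (forall t, t \in `[0, T] -> 0 <= c t) /\
    (forall t, t \in `[0, T] -> forall x p q : 'rV[R]_n,
       `|H t x p - H t x q| <= c t * (1 + enorm x) * enorm (p - q)).

Definition HLC (n : nat) (T : R) (H : R -> 'rV[R]_n -> 'rV[R]_n -> R) : Prop :=
  forall Rad : R, 0 < Rad -> exists k : R -> R, measurable_fun `[0, T] k /\
    (forall t, t \in `[0, T] -> 0 <= k t) /\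
    (forall t, t \in `[0, T] -> forall x y p : 'rV[R]_n,
       enorm x <= Rad -> enorm y <= Rad ->
       `|H t x p - H t y p| <= k t * (1 + enorm p) * enorm (x - y)).

Definition Hyp (n : nat) (T : R) (H : R -> 'rV[R]_n -> 'rV[R]_n -> R) : Prop :=
  H_continuous T H /\ H1 T H /\ H2 T H /\ H3 T H /\ H4 T H /\ HLC T H.

End Defs.

Definition unif_cvg_compact (R : realType) (X : topologicalType)
    (V : normedModType R) (D : set X) (F : nat -> X -> V) (g : X -> V) : Prop :=
  forall K : set X, compact K -> K `<=` D ->
    forall eps : R, 0 < eps ->
      exists N : nat, forall i : nat, (N <= i)%N ->
        forall q, K q -> `|F i q - g q| < eps.

(* Main.v *)
Require Import Defs.
From HB Require Import structures.
From mathcomp Require Import all_boot all_order all_algebra.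
From mathcomp Require Import all_classical all_reals all_analysis.
From mathcomp Require Import measurable_realfun ring lra.
Import Order.TTheory GRing.Theory Num.Theory.
Import numFieldNormedType.Exports.
Local Open Scope classical_set_scope.
Local Open Scope ring_scope.

(** By conjugacy, H(t,x,.) is the support function of E(t,x) in the directions
    (p,-1).  If a bounded point y of E_i were at distance > eps from E, the
    normal (P,-S) at its projection on E, tilted to (P,-(S + tau |y - w|)),
    would still separate y from E by a definite amount, since the last coordinate
    is bounded below by -H(t,x,0) on E; after rescaling this contradicts
    H_i(t,x,q) ~ H(t,x,q) at a point q bounded by 1/tau.  Hence the bounded parts
    of E_i and E are uniformly Hausdorff close, so are the truncations Phi_i and
    Phi (up to a factor 10), hence their support functions on the unit ball, and
    the Steiner point is an integral of the support function. *)

(** * Euclidean norm and projection onto closed convex sets *)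

Section Euclid.
Set Implicit Arguments.
Unset Strict Implicit.
Context {R : realType}.
Implicit Types m : nat.

Lemma dotvC m (u v : 'rV[R]_m) : dotv u v = dotv v u.
Proof. by apply: eq_bigr => j _; rewrite mulrC. Qed.

Lemma dotvDl m (u v w : 'rV[R]_m) : dotv (u + v) w = dotv u w + dotv v w.
Proof. by rewrite -big_split; apply: eq_bigr => j _; rewrite mxE mulrDl. Qed.

Lemma dotvZl m a (u w : 'rV[R]_m) : dotv (a *: u) w = a * dotv u w.
Proof. by rewrite mulr_sumr; apply: eq_bigr => j _; rewrite mxE mulrA. Qed.

Lemma dotvNl m (u w : 'rV[R]_m) : dotv (- u) w = - dotv u w.
Proof. by rewrite -scaleN1r dotvZl mulN1r. Qed.

Lemma dotvDr m (u v w : 'rV[R]_m) : dotv w (u + v) = dotv w u + dotv w v.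
Proof. by rewrite !(dotvC w) dotvDl. Qed.

Lemma dotvZr m a (u w : 'rV[R]_m) : dotv w (a *: u) = a * dotv w u.
Proof. by rewrite !(dotvC w) dotvZl. Qed.

Lemma dotvNr m (u w : 'rV[R]_m) : dotv w (- u) = - dotv w u.
Proof. by rewrite !(dotvC w) dotvNl. Qed.

Definition dotvE := (dotvDl, dotvDr, dotvZl, dotvZr, dotvNl, dotvNr).

Lemma dotv0r m (u : 'rV[R]_m) : dotv u 0 = 0.
Proof. by rewrite -(scale0r 0) dotvZr mul0r. Qed.

Lemma dotvv_ge0 m (u : 'rV[R]_m) : 0 <= dotv u u.
Proof. by apply: sumr_ge0 => j _; rewrite -expr2 sqr_ge0. Qed.

Lemma enorm_ge0 m (u : 'rV[R]_m) : 0 <= enorm u.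
Proof. exact: sqrtr_ge0. Qed.

Lemma sqr_enorm m (u : 'rV[R]_m) : enorm u ^+ 2 = dotv u u.
Proof. by rewrite sqr_sqrtr // dotvv_ge0. Qed.

Lemma coord_le_enorm m (u : 'rV[R]_m) j : `|u ord0 j| <= enorm u.
Proof.
rewrite -sqrtr_sqr ler_sqrt ?dotvv_ge0 //.
by rewrite /dotv (bigD1 j) //= -expr2 lerDl sumr_ge0 // => i _; rewrite -expr2 sqr_ge0.
Qed.

Lemma enorm_eq0 m (u : 'rV[R]_m) : enorm u = 0 -> u = 0.
Proof.
move=> u0; apply/rowP => j; rewrite mxE; apply/eqP.
by rewrite -normr_le0 -u0 coord_le_enorm.
Qed.

(** Cauchy-Schwarz: expand the nonnegative square of the norm of |v| u - |u| v and divide by |u|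
    |v|. *)
Lemma dotv_le m (u v : 'rV[R]_m) : dotv u v <= enorm u * enorm v.
Proof.
have [/enorm_eq0 ->|u0] := eqVneq (enorm u) 0.
  by rewrite dotvC dotv0r mulr_ge0 ?enorm_ge0.
have [/enorm_eq0 ->|v0] := eqVneq (enorm v) 0.
  by rewrite dotv0r mulr_ge0 ?enorm_ge0.
have up : 0 < enorm u by rewrite lt_neqAle eq_sym u0 enorm_ge0.
have vp : 0 < enorm v by rewrite lt_neqAle eq_sym v0 enorm_ge0.
have := dotvv_ge0 (enorm v *: u - enorm u *: v).
rewrite !dotvE -!sqr_enorm (dotvC v u) => h.
have uv : 0 < enorm u * enorm v by rewrite mulr_gt0.
rewrite -(ler_pM2l uv); nra.
Qed.

Lemma enormN m (u : 'rV[R]_m) : enorm (- u) = enorm u.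
Proof. by rewrite /enorm !dotvE opprK. Qed.

Lemma enormBC m (u v : 'rV[R]_m) : enorm (u - v) = enorm (v - u).
Proof. by rewrite -enormN opprB. Qed.

Lemma enormZ m a (u : 'rV[R]_m) : enorm (a *: u) = `|a| * enorm u.
Proof. by rewrite /enorm !dotvE mulrA -expr2 sqrtrM ?sqr_ge0 // sqrtr_sqr. Qed.

Lemma enorm0 m : enorm (0 : 'rV[R]_m) = 0.
Proof. by rewrite /enorm dotv0r sqrtr0. Qed.

Lemma enormD m (u v : 'rV[R]_m) : enorm (u + v) <= enorm u + enorm v.
Proof.
rewrite -(ler_pXn2r (n := 2)) ?nnegrE ?addr_ge0 ?enorm_ge0 //.
by rewrite sqr_enorm !dotvE (dotvC v u) -!sqr_enorm; have := dotv_le u v; lra.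
Qed.

Lemma enormB_triangle m (u v w : 'rV[R]_m) :
  enorm (u - w) <= enorm (u - v) + enorm (v - w).
Proof. by rewrite (le_trans _ (enormD _ _)) // addrA subrK. Qed.

(** Here [|u|] is the max norm, which carries the topology; with [normr_le_enorm] this passes
    between it and the Euclidean norm. *)
Lemma enorm_le_normr m (u : 'rV[R]_m) : enorm u <= m%:R * `|u|.
Proof.
rewrite -(ler_pXn2r (n := 2)) ?nnegrE ?mulr_ge0 ?enorm_ge0 // sqr_enorm exprMn.
apply: (@le_trans _ _ (\sum_(j < m) `|u| ^+ 2)).
  apply: ler_sum => j _; rewrite -expr2 -real_normK ?num_real //.
  rewrite ler_pXn2r ?nnegrE // [leRHS]/Num.Def.normr /= mx_normrE.
  by apply/bigmax_geP; right => /=; exists (ord0, j).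
rewrite sumr_const card_ord -[leLHS]mulr_natl ler_wpM2r ?sqr_ge0 //.
by rewrite -natrX ler_nat; case: m {u} => // m; rewrite leq_pmull.
Qed.

Lemma normr_le_enorm m (u : 'rV[R]_m) : `|u| <= enorm u.
Proof.
rewrite [leLHS]/Num.Def.normr /= mx_normrE (bigmax_le _ (enorm_ge0 u)) // => -[i j] _ /=.
by rewrite ord1 coord_le_enorm.
Qed.

Lemma coord_rV_continuous m (j : 'I_m) : continuous (fun u : 'rV[R]_m => u ord0 j).
Proof. exact: coord_continuous. Qed.

Lemma dotv_continuous m (v : 'rV[R]_m) : continuous (fun u => dotv u v).
Proof.
apply: continuous_big => [|j _ u]; first exact: add_continuous.
exact: (cvgM (@coord_rV_continuous m j u) (cvg_cst _)).
Qed.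

Lemma enorm_continuous m (a : 'rV[R]_m) : continuous (fun u : 'rV[R]_m => enorm (a - u)).
Proof.
move=> u; apply: (@continuous_comp _ _ _ (fun u : 'rV[R]_m => dotv (a - u) (a - u)) Num.sqrt).
  apply: continuous_big u => [|j _ u]; first exact: add_continuous.
  have h : (a - y) ord0 j @[y --> u] --> (a - u) ord0 j.
    under eq_fun do rewrite !mxE.
    by rewrite !mxE; exact: (cvgB (cvg_cst _) (@coord_rV_continuous m j u)).
  exact: (cvgM h h).
exact: sqrt_continuous.
Qed.

Lemma compact_cball m (a : 'rV[R]_m) r : compact (cball a r).
Proof.
apply: bounded_closed_compact.
  exists (enorm a + r); split; first exact: num_real.
  move=> M hM y /= yb; apply: le_trans (ltW hM).
  apply: (le_trans (normr_le_enorm _)).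
  have -> : y = a - (a - y) by rewrite opprB addrC subrK.
  by rewrite (le_trans (enormD _ _)) // enormN lerD2l.
by apply: (preimage_closed _ (@closed_le R r)) => y _; exact: enorm_continuous.
Qed.

(** The distance is minimised over the compact part of E lying in the ball through a known point z0;
    points outside that ball are farther than z0. *)
Lemma nearest_point m (E : set 'rV[R]_m) (a : 'rV[R]_m) :
  closed E -> E !=set0 ->
  exists2 w, E w & forall z, E z -> enorm (a - w) <= enorm (a - z).
Proof.
move=> cE [z0 Ez0]; pose C := E `&` cball a (enorm (a - z0)).
have Cz0 : C z0 by split=> //; rewrite /cball /=.
have : compact C by rewrite /C setIC; exact: compact_closedI (@compact_cball _ a _) cE.
move=> /(@compact_EVT_min _ _ (fun u : 'rV[R]_m => enorm (a - u)) C (ex_intro _ _ Cz0)).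
case=> [|w]; first by apply: continuous_subspaceT; exact: enorm_continuous.
rewrite inE => -[Ew _] wmin; exists w => // z Ez.
have [zle|/ltW zgt] := leP (enorm (a - z)) (enorm (a - z0)).
  by apply: wmin; rewrite inE; split.
by rewrite (le_trans (wmin z0 _)) // inE.
Qed.

Definition convexset {m} (E : set 'rV[R]_m) :=
  forall (x y : 'rV[R]_m) (l : R), E x -> E y -> 0 <= l <= 1 -> E ((1 - l) *: x + l *: y).

(* First-order optimality at l = 0 of the distance from a to (1 - l) w + l z. *)
Lemma nearest_obtuse m (E : set 'rV[R]_m) (a w z : 'rV[R]_m) :
  convexset E -> E w -> (forall y, E y -> enorm (a - w) <= enorm (a - y)) ->
  E z -> dotv (a - w) (z - w) <= 0.
Proof.
move=> cE Ew wmin Ez; rewrite leNgt; apply/negP => c0.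
set c := dotv _ _ in c0; set b := dotv (z - w) (z - w).
have b0 : 0 <= b by exact: dotvv_ge0.
(* Adding c to b keeps the denominator positive and l <= 1, while l b < c still makes the distance
   drop strictly. *)
pose l := c / (b + c).
have bc : 0 < b + c by lra.
have l0 : 0 < l by rewrite divr_gt0.
have l1 : l <= 1 by rewrite ler_pdivrMr // mul1r lerDr.
have lbc : l * (b + c) = c by rewrite /l divfK // gt_eqF.
have := wmin ((1 - l) *: w + l *: z) (cE _ _ _ Ew Ez _).
rewrite (ltW l0) l1 => /(_ isT).
rewrite -(ler_pXn2r (n := 2)) ?nnegrE ?enorm_ge0 // !sqr_enorm.
have -> : a - ((1 - l) *: w + l *: z) = (a - w) - l *: (z - w).
  by apply/rowP => j; rewrite !mxE; ring.
move: (a - w) (z - w) @b @c c0 b0 @l bc l0 l1 lbc => u v b c c0 b0 l bc l0 l1 lbc.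
rewrite !dotvE (dotvC v) -/b -/c => h.
have : l * (l * b) - 2 * (l * c) >= 0 by lra.
have -> : l * (l * b) - 2 * (l * c) = l * (l * (b + c) - l * c - 2 * c) by ring.
rewrite lbc pmulr_rge0 //.
have : 0 < l * c by rewrite mulr_gt0.
lra.
Qed.

Lemma edist_nearest m (E : set 'rV[R]_m) (a w : 'rV[R]_m) :
  E w -> (forall y, E y -> enorm (a - w) <= enorm (a - y)) ->
  Defs.edist a E = enorm (a - w).
Proof.
move=> Ew wmin; apply/eqP; rewrite eq_le; apply/andP; split.
  apply: ge_inf; last by exists w.
  by exists 0 => _ [y _ <-]; exact: enorm_ge0.
by apply: lb_le_inf; [exists (enorm (a - w)), w|move=> _ [y Ey <-]; exact: wmin].
Qed.

End Euclid.

(** * Epigraphs of conjugates and their dependence on the function *)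

Section Conjugate.
Context {R : realType}.
Set Implicit Arguments.
Unset Strict Implicit.
Implicit Types n : nat.

(** The epigraph of the conjugate as a family of real inequalities, so that no extended-real
    supremum has to be handled. *)
Definition epiconj {n} (h : 'rV[R]_n -> R) : set 'rV[R]_(n + 1) :=
  [set a | forall p, dotv (vpart a) p - etapart a <= h p].

Definition epigraph {n} (h : 'rV[R]_n -> R) : set 'rV[R]_(n + 1) :=
  [set a | h (vpart a) <= etapart a].

Definition convexfun {n} (h : 'rV[R]_n -> R) :=
  forall p q (l : R), 0 <= l <= 1 -> h (l *: p + (1 - l) *: q) <= l * h p + (1 - l) * h q.

Lemma epiHconjE n (H : R -> 'rV[R]_n -> 'rV[R]_n -> R) t x :
  epiHconj H t x = epiconj (H t x).
Proof.
apply/seteqP; split=> a /=.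
  move=> h p; rewrite lerBlDr addrC -lerBlDr -lee_fin; apply: le_trans h.
  by apply: ereal_sup_ubound; exists p.
move=> h; apply: ge_ereal_sup => _ [p _ <-].
by rewrite lee_fin lerBlDr addrC -lerBlDr.
Qed.

Definition mkpair {n} (v : 'rV[R]_n) (r : R) : 'rV[R]_(n + 1) := row_mx v (const_mx r).

Lemma vpart_mkpair n (v : 'rV[R]_n) r : vpart (mkpair v r) = v.
Proof. exact: row_mxKl. Qed.

Lemma etapart_mkpair n (v : 'rV[R]_n) r : etapart (mkpair v r) = r.
Proof. by rewrite /etapart row_mxKr mxE. Qed.

Lemma vpartD n (a b : 'rV[R]_(n + 1)) : vpart (a + b) = vpart a + vpart b.
Proof. exact: linearD. Qed.

Lemma vpartB n (a b : 'rV[R]_(n + 1)) : vpart (a - b) = vpart a - vpart b.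
Proof. exact: linearB. Qed.

Lemma vpartZ n c (a : 'rV[R]_(n + 1)) : vpart (c *: a) = c *: vpart a.
Proof. exact: linearZ. Qed.

Lemma etapartD n (a b : 'rV[R]_(n + 1)) : etapart (a + b) = etapart a + etapart b.
Proof. by rewrite /etapart !mxE. Qed.

Lemma etapartB n (a b : 'rV[R]_(n + 1)) : etapart (a - b) = etapart a - etapart b.
Proof. by rewrite /etapart !mxE. Qed.

Lemma etapartZ n c (a : 'rV[R]_(n + 1)) : etapart (c *: a) = c * etapart a.
Proof. by rewrite /etapart !mxE. Qed.

Definition partE := (vpartB, etapartB, vpartD, etapartD, vpartZ, etapartZ,
  vpart_mkpair, etapart_mkpair).

Lemma dotv_parts n (a b : 'rV[R]_(n + 1)) :
  dotv a b = dotv (vpart a) (vpart b) + etapart a * etapart b.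
Proof.
rewrite /dotv big_split_ord /= big_ord1; congr (_ + _); last by rewrite /etapart !mxE.
by apply: eq_bigr => j _; rewrite !mxE.
Qed.

Lemma enorm_vpart_le n (a : 'rV[R]_(n + 1)) : enorm (vpart a) <= enorm a.
Proof.
by rewrite ler_sqrt ?dotvv_ge0 // (dotv_parts a) lerDl -expr2 sqr_ge0.
Qed.

Lemma normr_etapart_le n (a : 'rV[R]_(n + 1)) : `|etapart a| <= enorm a.
Proof.
by rewrite -sqrtr_sqr ler_sqrt ?dotvv_ge0 // (dotv_parts a) expr2 lerDr dotvv_ge0.
Qed.

Lemma enorm_le_parts n (a : 'rV[R]_(n + 1)) : enorm a <= enorm (vpart a) + `|etapart a|.
Proof.
rewrite -(ler_pXn2r (n := 2)) ?nnegrE ?addr_ge0 ?enorm_ge0 //.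
rewrite sqr_enorm dotv_parts sqrrD sqr_enorm real_normK ?num_real // -expr2.
by have := mulr_ge0 (enorm_ge0 (vpart a)) (normr_ge0 (etapart a)); lra.
Qed.

Lemma vpart_continuous n : continuous (@vpart R n).
Proof. exact: continuous_lsubmx. Qed.

Lemma etapart_continuous n : continuous (@etapart R n).
Proof.
rewrite (_ : @etapart R n = fun a => a ord0 (rshift n ord0)); first exact: coord_rV_continuous.
by apply/funext => a; rewrite /etapart mxE.
Qed.

Lemma closed_epigraph n (h : 'rV[R]_n -> R) : continuous h -> closed (epigraph h).
Proof.
move=> ch; rewrite (_ : epigraph h = (fun a => h (vpart a) - etapart a) @^-1` [set r | r <= 0]).
  apply: (preimage_closed _ (@closed_le R 0)) => a _.
  have c1 : {for a, continuous (h \o @vpart R n)}.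
    exact: (continuous_comp (@vpart_continuous n a) (ch _)).
  exact: (cvgB c1 (@etapart_continuous n a)).
by apply/seteqP; split=> a /=; rewrite subr_le0.
Qed.

Lemma closed_epiconj n (h : 'rV[R]_n -> R) : closed (epiconj h).
Proof.
rewrite (_ : epiconj h = \bigcap_(p in setT)
    ((fun a => dotv (vpart a) p - etapart a) @^-1` [set r | r <= h p])).
  apply: closed_bigI => p _.
  apply: (preimage_closed _ (@closed_le R (h p))) => a _.
  have c1 : {for a, continuous ((fun u => dotv u p) \o @vpart R n)}.
    exact: (continuous_comp (@vpart_continuous n a) (@dotv_continuous _ _ p _)).
  exact: (cvgB c1 (@etapart_continuous n a)).
by apply/seteqP; split=> a /= h' p; [move=> _|]; exact: h'.
Qed.

Lemma convex_epigraph n (h : 'rV[R]_n -> R) : convexfun h -> convexset (epigraph h).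
Proof.
move=> ch x y l xE yE l01; rewrite /epigraph /= !partE.
have l01' : 0 <= 1 - l <= 1 by lra.
apply: le_trans (_ : (1 - l) * h (vpart x) + l * h (vpart y) <= _).
  by have := ch (vpart x) (vpart y) _ l01'; rewrite subKr.
by apply: lerD; apply: ler_wpM2l => //; lra.
Qed.

Lemma convex_epiconj n (h : 'rV[R]_n -> R) : convexset (epiconj h).
Proof.
move=> x y l xE yE l01 p; rewrite !partE !dotvE.
have h1 : (1 - l) * (dotv (vpart x) p - etapart x) <= (1 - l) * h p.
  by apply: ler_wpM2l (xE p); lra.
have h2 : l * (dotv (vpart y) p - etapart y) <= l * h p.
  by apply: ler_wpM2l (yE p); lra.
lra.
Qed.

(* Approximate Fenchel-Moreau: the normal at the projection of (q, h q - e) on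
   the epigraph of h is not horizontal, so it is the graph of an affine minorant. *)
Lemma affine_minorant n (h : 'rV[R]_n -> R) q e :
  convexfun h -> continuous h -> 0 < e ->
  exists2 a, epiconj h a & h q - e <= dotv (vpart a) q - etapart a.
Proof.
move=> convh ch e0; pose b := mkpair q (h q - e).
have qE : epigraph h (mkpair q (h q)) by rewrite /epigraph /= !partE.
have [w wE wmin] := nearest_point b (closed_epigraph ch) (ex_intro _ _ qE).
have obt z := nearest_obtuse (convex_epigraph convh) wE wmin (z := z).
have {}obt p r : h p <= r ->
    dotv (q - vpart w) (p - vpart w) + (h q - e - etapart w) * (r - etapart w) <= 0.
  move=> hpr; have /obt : epigraph h (mkpair p r) by rewrite /epigraph /= !partE.
  by rewrite dotv_parts /b !partE.
set s := etapart w - (h q - e).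
have wE' : h (vpart w) <= etapart w := wE.
(* Raising w by 1 stays in the epigraph, so the normal cannot point upwards. *)
have s0 : 0 <= s.
  have := obt (vpart w) (etapart w + 1) ltac:(lra).
  by rewrite subrr dotv0r /s; lra.
have sq : dotv (q - vpart w) (q - vpart w) <= s * (h q - etapart w).
  by have := obt q (h q) (lexx _); rewrite /s; lra.
(* If s = 0, then q = [vpart w] and w would lie at height h q - e, strictly below the graph. *)
have {s0} sp : 0 < s.
  rewrite lt_neqAle s0 andbT; apply/eqP => s00.
  have qw : q = vpart w.
    apply/subr0_eq/enorm_eq0/eqP; rewrite -sqrf_eq0 sqr_enorm eq_le dotvv_ge0 andbT.
    by rewrite (le_trans sq) // -s00 mul0r.
  by move: s00 wE'; rewrite -qw /s; lra.
(* Scaling the normal to last coordinate -1 gives the slope; the intercept makes the minorant pass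
   through w. *)
pose v := s^-1 *: (q - vpart w).
exists (mkpair v (dotv v (vpart w) - etapart w)).
  move=> p; rewrite !partE.
  have := obt p (h p) (lexx _); rewrite -(pmulr_rle0 _ (x := s^-1)) ?invr_gt0 //.
  rewrite mulrDr -dotvZl -/v mulrA (_ : s^-1 * _ = -1); last first.
    by rewrite -(opprB (etapart w)) mulrN mulVf // gt_eqF.
  by rewrite dotvDr dotvNr; lra.
rewrite !partE.
have : 0 <= dotv v (q - vpart w) by rewrite dotvZl mulr_ge0 ?dotvv_ge0 // invr_ge0 ltW.
rewrite dotvDr dotvNr; move: sp; rewrite /s; lra.
Qed.

(** P and gam are fixed before g and k: this is what later makes the estimate uniform in i, t and x.
    The bound is one-sided and gets applied twice with the roles exchanged. *)
Lemma epiconj_excess n (M rho eps : R) : 0 <= M -> 0 <= rho -> 0 < eps ->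
  exists P gam : R, [/\ 0 < P, 0 < gam &
    forall g k : 'rV[R]_n -> R, convexfun k -> continuous k -> k 0 <= M ->
    (forall q, enorm q <= P -> `|g q - k q| <= gam) ->
    forall y, epiconj g y -> enorm y <= rho ->
    exists2 z, epiconj k z & enorm (y - z) <= eps].
Proof.
(* The constants split a budget d eps, d being the distance from y to its projection: the tilt costs
   at most one half, the error gam one quarter, and the slack gam / 2 of the affine minorant one
   eighth. *)
move=> M0 rho0 eps0; pose tau := eps / (2 * (rho + M + 1)).
have tau0 : 0 < tau by rewrite divr_gt0 //; lra.
have tauE : 2 * (tau * (rho + M + 1)) = eps.
  by rewrite /tau; field; rewrite gt_eqF //; lra.
pose gam := eps / (4 * (1 + tau)).
have gam0 : 0 < gam by rewrite divr_gt0 //; lra.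
have gamE : 4 * (gam * (1 + tau)) = eps by rewrite /gam; field; rewrite gt_eqF //; lra.
exists tau^-1, gam; split; rewrite ?invr_gt0 // => g k convk ck k0 gk y yE yrho.
have kE : epiconj k !=set0 by have [a aE _] := affine_minorant 0 convk ck ltr01; exists a.
have [w wE wmin] := nearest_point y (closed_epiconj (h:=k)) kE.
have obt z := nearest_obtuse (@convex_epiconj _ k) wE wmin (z := z).
exists w => //; rewrite leNgt; apply/negP => far.
have [D DE] : exists D, D = y - w by exists (y - w).
rewrite -DE in obt far; set d := enorm D in far.
pose S := - etapart D.
(* The epigraph is stable under raising the last coordinate. *)
have S0 : 0 <= S.
  have : epiconj k (w + mkpair 0 1).
    by move=> p; have := wE p; rewrite !partE addr0; lra.
  by move=> /obt; rewrite addrAC subrr add0r dotv_parts !partE dotv0r /S; lra.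
have Sd : S <= d by rewrite (le_trans (ler_norm _)) // normrN normr_etapart_le.
have d0 : 0 < d by rewrite (lt_trans eps0).
pose S' := S + tau * d.
have td : 0 < tau * d by rewrite mulr_gt0.
have S'0 : 0 < S' by rewrite /S'; lra.
(* Since |[vpart D]| <= d and S' >= tau d, q is bounded by 1 / tau even if the normal D is
   horizontal. *)
pose q := S'^-1 *: vpart D.
have qP : enorm q <= tau^-1.
  rewrite enormZ gtr0_norm ?invr_gt0 // mulrC ler_pdivrMr // mulrC ler_pdivlMr //.
  rewrite mulrC (le_trans _ (_ : tau * d <= _)) ?ler_wpM2l ?enorm_vpart_le ?(ltW tau0) //.
  by rewrite /S'; lra.
have [z zE zq] := affine_minorant q convk ck (divr_gt0 gam0 (ltr0n _ 2)).
have Dyz : d ^+ 2 <= dotv D (y - z).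
  rewrite sqr_enorm (_ : y - z = D - (z - w)); last by rewrite DE opprB addrA subrK.
  by rewrite dotvDr dotvNr lerDl oppr_ge0; exact: obt.
have DS : vpart D = S' *: q by rewrite /q scalerA divff ?scale1r // gt_eqF.
have zq' : S' * (k q - gam / 2) <= S' * (dotv (vpart z) q - etapart z).
  by rewrite ler_wpM2l // ltW.
have yq' : S' * (dotv (vpart y) q - etapart y) <= S' * g q by rewrite ler_wpM2l // ltW.
have gkq : S' * (g q - k q) <= S' * gam.
  by rewrite ler_wpM2l ?(ltW S'0) // (le_trans (ler_norm _)) // gk.
have etaz : - M <= etapart z by have := zE 0; rewrite dotv0r; lra.
have etay : etapart y <= rho by rewrite (le_trans (ler_norm _)) // (le_trans (normr_etapart_le _)).
have tdle : tau * d * (etapart y - etapart z) <= tau * d * (rho + M + 1).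
  by rewrite ler_wpM2l ?(ltW td) //; lra.
have S'le : S' * gam <= (d * (1 + tau)) * gam.
  by rewrite ler_wpM2r ?(ltW gam0) // /S'; lra.
(* Now d^2 <= <D, y - z> splits into S' times a difference of affine values at q, plus the tilt tau
   d times the difference of last coordinates; the total is at most 7/8 of d eps, which is less than
   d^2. *)
move: Dyz; rewrite dotv_parts !partE DS dotvZl dotvDr dotvNr !(dotvC q).
have -> : etapart D = tau * d - S' by rewrite /S' /S; ring.
have dd : d * eps < d ^+ 2 by rewrite expr2 ltr_pM2l.
have : d * eps = 4 * (d * (1 + tau) * gam) by rewrite -gamE; ring.
have : d * eps = 2 * (tau * d * (rho + M + 1)) by rewrite -tauE; ring.
move: zq' yq' gkq tdle S'le; clearbody S' d q gam tau.
move: (dotv (vpart y) q) (dotv (vpart z) q) (etapart y) (etapart z) (g q) (k q) dd.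
clear => A B ey ez gq kq dd; nra.
Qed.

(** The minorant that is 1-exact at 0 has |eta| <= M + 1; testing it at the unit vector along its
    slope bounds the slope by 2 M + 1. *)
Lemma epiconj_bounded_point n (M : R) (k : 'rV[R]_n -> R) :
  convexfun k -> continuous k -> (forall q, enorm q <= 1 -> `|k q| <= M) ->
  exists2 z, epiconj k z & enorm z <= 3 * M + 2.
Proof.
move=> convk ck kM; have [z zE z0] := affine_minorant 0 convk ck ltr01.
exists z => //; move: z0 (zE 0); rewrite dotv0r => z0 z1.
have k0M : `|k 0| <= M by apply: kM; rewrite enorm0 ler01.
move: k0M; rewrite ler_norml => /andP[k0l k0r].
have M0 : 0 <= M by lra.
have eM : `|etapart z| <= M + 1 by rewrite ler_norml; apply/andP; split; lra.
have vM : enorm (vpart z) <= 2 * M + 1.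
  have [->|v0] := eqVneq (enorm (vpart z)) 0; first lra.
  have vp : 0 < enorm (vpart z) by rewrite lt_neqAle eq_sym v0 enorm_ge0.
  pose p := (enorm (vpart z))^-1 *: vpart z.
  have p1 : enorm p = 1 by rewrite enormZ gtr0_norm ?invr_gt0 // mulVf.
  have := zE p; rewrite dotvZr -sqr_enorm expr2 mulKf //.
  have := kM p; rewrite p1 lexx => /(_ isT); rewrite !ler_norml => /andP[_].
  move: eM; rewrite ler_norml => /andP[_]; lra.
by have := enorm_le_parts z; lra.
Qed.

End Conjugate.

(** * Stability of the truncation by the ball of radius twice the distance *)

Section Truncation.
Context {R : realType}.
Set Implicit Arguments.
Unset Strict Implicit.

(* A point z of E within del of y is moved into the ball of radius 2 d(a,E) along
   the segment to the projection w of a, by the fraction 3 del / (d + 3 del). *)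
Lemma truncation_excess m (E E' : set 'rV[R]_m) (a : 'rV[R]_m) (D del rho : R) :
  convexset E -> closed E -> E !=set0 -> closed E' -> E' !=set0 ->
  0 < del -> Defs.edist a E <= D -> Defs.edist a E' <= D -> enorm a + 2 * D <= rho ->
  (forall y, E y -> enorm y <= rho -> exists2 z, E' z & enorm (y - z) <= del) ->
  (forall y, E' y -> enorm y <= rho -> exists2 z, E z & enorm (y - z) <= del) ->
  forall y, E' y -> cball a (2 * Defs.edist a E') y ->
  exists2 z, (E `&` cball a (2 * Defs.edist a E)) z & enorm (y - z) <= 10 * del.
Proof.
move=> cE clE nE clE' nE' del0 dD d'D rhoD EE' E'E y E'y; rewrite /cball /= => yb.
have norm_le b : enorm b <= enorm a + enorm (a - b).
  have -> : b = a - (a - b) by rewrite opprB addrC subrK.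
  by rewrite (le_trans (enormD _ _)) // enormN lerD2l opprB addrCA subrr addr0.
have [w Ew wmin] := nearest_point a clE nE.
have [w' Ew' wmin'] := nearest_point a clE' nE'.
rewrite (edist_nearest Ew wmin) in dD *.
rewrite (edist_nearest Ew' wmin') in d'D yb.
set d := enorm (a - w) in dD wmin *; set d' := enorm (a - w') in d'D wmin' yb.
have d0 : 0 <= d by exact: enorm_ge0.
have d'd : d' <= d + del.
  have [|z' Ez' wz'] := EE' w Ew; first by have := norm_le w; rewrite -/d; lra.
  have := wmin' z' Ez'; have := enormB_triangle a w z'; rewrite -/d; lra.
have [|z Ez yz] := E'E y E'y; first by have := norm_le y; lra.
(* Doubling d' <= d + del costs 2 del, and |y - z| costs one more. *)
have az : enorm (a - z) <= 2 * d + 3 * del.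
  by have := enormB_triangle a y z; lra.
(* The solution of (1 - l) (2 d + 3 del) + l d = 2 d. *)
pose l := 3 * del / (d + 3 * del).
have dd0 : 0 < d + 3 * del by lra.
have l0 : 0 <= l by rewrite divr_ge0 //; lra.
have lE : l * (d + 3 * del) = 3 * del by rewrite /l divfK // gt_eqF.
have l1 : l <= 1 by rewrite ler_pdivrMr //; lra.
exists ((1 - l) *: z + l *: w); first split.
- by apply: cE => //; rewrite l0.
- rewrite /=.
  have -> : a - ((1 - l) *: z + l *: w) = (1 - l) *: (a - z) + l *: (a - w).
    by apply/rowP => j; rewrite !mxE; ring.
  rewrite (le_trans (enormD _ _)) // !enormZ !ger0_norm ?subr_ge0 // -/d.
  have : (1 - l) * enorm (a - z) <= (1 - l) * (2 * d + 3 * del).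
    by rewrite ler_wpM2l // subr_ge0.
  lra.
- have -> : y - ((1 - l) *: z + l *: w) = (y - z) + l *: (z - w).
    by apply/rowP => j; rewrite !mxE; ring.
  rewrite (le_trans (enormD _ _)) // enormZ ger0_norm //.
  (* Hence l |z - w| <= 9 del, and |y - z| contributes the tenth del. *)
  have : enorm (z - w) <= 3 * (d + 3 * del).
    have := enormB_triangle z a w; rewrite (enormBC z a) -/d; lra.
  move=> /(ler_wpM2l l0); lra.
Qed.

End Truncation.

(** * Support functions of bounded sets *)

Section Support.
Context {R : realType}.
Set Implicit Arguments.
Unset Strict Implicit.
Implicit Types m : nat.

(** The real [sup] is a genuine supremum only on nonempty bounded sets; this supplies that side
    condition. *)
Lemma has_sup_support m (K : set 'rV[R]_m) B p : K !=set0 ->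
  (forall y, K y -> enorm y <= B) -> has_sup [set dotv p y | y in K].
Proof.
move=> [y0 Ky0] KB; split; first by exists (dotv p y0), y0.
exists (enorm p * B) => _ [y Ky <-].
by rewrite (le_trans (dotv_le _ _)) // ler_wpM2l ?enorm_ge0 // KB.
Qed.

Lemma supportf_excess m (K L : set 'rV[R]_m) B del p : K !=set0 ->
  L !=set0 -> (forall y, L y -> enorm y <= B) -> enorm p <= 1 ->
  (forall y, K y -> exists2 z, L z & enorm (y - z) <= del) ->
  supportf K p <= supportf L p + del.
Proof.
move=> [y0 Ky0] L0 LB p1 KL.
apply: ge_sup; first by exists (dotv p y0), y0.
move=> _ [y Ky <-]; have [z Lz yz] := KL y Ky.
have -> : y = z + (y - z) by rewrite addrC subrK.
rewrite dotvDr; apply: lerD.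
  by apply: ub_le_sup; [have [] := has_sup_support p L0 LB|exists z].
rewrite (le_trans (dotv_le _ _)) // (le_trans (ler_wpM2l (enorm_ge0 _) yz)) //.
by rewrite -[leRHS]mul1r ler_wpM2r // (le_trans (enorm_ge0 _) yz).
Qed.

(** Gives the continuity of the Steiner integrand and, with q = 0, its bound on the unit ball. *)
Lemma supportf_lipschitz m (K : set 'rV[R]_m) B p q : K !=set0 ->
  (forall y, K y -> enorm y <= B) ->
  `|supportf K p - supportf K q| <= B * enorm (p - q).
Proof.
move=> K0 KB.
suff H u v : supportf K u - supportf K v <= B * enorm (u - v).
  by rewrite ler_norml H andbT lerNl opprB enormBC H.
rewrite lerBlDl; apply: ge_sup; first by case: K0 => y Ky; exists (dotv u y), y.
move=> _ [y Ky <-]; have -> : u = v + (u - v) by rewrite addrC subrK.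
rewrite dotvDl; apply: lerD.
  by apply: ub_le_sup; [have [] := has_sup_support v K0 KB|exists y].
rewrite addrAC subrr add0r (le_trans (dotv_le _ _)) // mulrC.
by rewrite ler_wpM2r ?enorm_ge0 // KB.
Qed.

Lemma supportf0 m (K : set 'rV[R]_m) : K !=set0 -> supportf K 0 = 0.
Proof.
move=> [y Ky]; rewrite /supportf (_ : [set _ | _ in _] = [set 0]) ?sup1 //.
apply/seteqP; split=> [_ [z _ <-]|_ ->] /=; first by rewrite dotvC dotv0r.
by exists y => //; rewrite dotvC dotv0r.
Qed.

End Support.

(** * Additivity and dominated convergence for the iterated integral *)

Section IteratedIntegral.
Context {R : realType}.
Set Implicit Arguments.
Unset Strict Implicit.
Implicit Types m : nat.
Notation mu := (@lebesgue_measure R).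

(** Wider than [-1, 1] because the continuous approximations of functions on the unit ball spill
    over up to norm 2. Its length is the factor 4 in the bounds below. *)
Definition window : set R := `[-2, 2]%classic.

Lemma integrable_window (C : R) : mu.-integrable setT (EFin \o (fun r => C * \1_window r)).
Proof.
rewrite (_ : _ \o _ = (fun r => C%:E * (\1_window r)%:E)%E); last first.
  by apply/funext => r /=; rewrite EFinM.
by apply: integrableZl => //; exact: (@integrable_indic_itv R (-2) 2 true false).
Qed.

Lemma Rintegral_window (C : R) : \int[mu]_r (C * \1_window r) = 4 * C.
Proof.
rewrite RintegralZl //; last exact: (@integrable_indic_itv R (-2) 2 true false).
have mw : measurable window by exact: measurable_itv.
rewrite /Rintegral integral_indic // setIT /= lebesgue_measure_itv /= lte_fin.
by rewrite ifT /=; [ring|lra].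
Qed.

Lemma window_integral (F : R -> R) (C : R) : measurable_fun setT F ->
  (forall r, `|F r| <= C * \1_window r) ->
  mu.-integrable setT (EFin \o F) /\ `|\int[mu]_r F r| <= 4 * C.
Proof.
move=> mF FC; have iF : mu.-integrable setT (EFin \o F).
  apply: le_integrable (integrable_window C) => //.
    exact/measurable_EFinP.
  by move=> r _ /=; rewrite lee_fin (le_trans (FC r)) // ler_norm.
split=> //; rewrite -Rintegral_window.
apply: le_trans (le_normr_Rintegral _ iF) _ => //.
by apply: le_Rintegral => //; [exact: integrable_norm|exact: integrable_window].
Qed.

Definition slice {m} (g : 'rV[R]_m.+1 -> R) (r : R) : 'rV[R]_m -> R :=
  fun y => g (row_mx (const_mx r : 'rV[R]_1) y).

(* [iint] integrates nested [Rintegral]s, which are additive only on measurable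
   functions: measurability is needed at every level of the iteration. *)
Fixpoint itermeas m : ('rV[R]_m -> R) -> Prop :=
  match m return ('rV[R]_m -> R) -> Prop with
  | 0 => fun=> True
  | m'.+1 => fun g =>
      (forall r, itermeas (@slice m' g r)) /\ measurable_fun setT (fun r => iint (@slice m' g r))
  end.

Definition boxed m (M : R) (g : 'rV[R]_m -> R) :=
  (forall x, `|g x| <= M) /\
  (forall x, g x != 0 -> forall j, `|x ord0 j| <= 2).

Lemma boxed_ge0 m M (g : 'rV[R]_m -> R) : boxed M g -> 0 <= M.
Proof. by move=> [gM _]; rewrite (le_trans (normr_ge0 _) (gM 0)). Qed.

(** The indicator records that the slice vanishes identically for r outside the window, which yields
    an integrable majorant in the outer variable. *)
Lemma boxed_slice m M (g : 'rV[R]_m.+1 -> R) r :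
  boxed M g -> boxed (M * \1_window r) (slice g r).
Proof.
move=> [gM g2]; have sup x j : slice g r x != 0 ->
    `|(row_mx (const_mx r : 'rV[R]_1) x : 'rV[R]_m.+1) ord0 j| <= 2 by move=> /g2; exact.
split=> [x|x sx j]; last first.
  by have := sup x (@rshift 1 m j) sx; rewrite (@row_mxEr _ _ 1).
have [->|sx] := eqVneq (slice g r x) 0.
  by rewrite normr0 mulr_ge0 ?(boxed_ge0 (conj gM g2)) // indicE.
have : window r.
  have := sup x (@lshift 1 m ord0) sx; rewrite (@row_mxEl _ _ 1) mxE ler_norml.
  by rewrite /window /= in_itv.
by move=> rw; rewrite indicE mem_set // mulr1 gM.
Qed.

Lemma iint_le m M (g : 'rV[R]_m -> R) :
  itermeas g -> boxed M g -> `|iint g| <= 4 ^+ m * M.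
Proof.
elim: m M g => [|m IH] M g /=; first by move=> _ [gM _]; rewrite expr0 mul1r gM.
move=> [mg mI] bg; rewrite exprS -mulrA.
apply: (window_integral mI _).2 => r.
by rewrite -mulrA; exact: IH (mg r) (boxed_slice r bg).
Qed.

Lemma iint_integrable m M (g : 'rV[R]_m.+1 -> R) : itermeas g -> boxed M g ->
  mu.-integrable setT (EFin \o (fun r => iint (slice g r))).
Proof.
move=> [mg mI] bg; apply: (window_integral (C := 4 ^+ m * M) mI _).1 => r.
by rewrite -mulrA; exact: iint_le (mg r) (boxed_slice r bg).
Qed.

(** Measurability of the difference is carried through the same induction, since it comes from
    additivity one level below. *)
Lemma iintB m M N (g h : 'rV[R]_m -> R) :
  itermeas g -> boxed M g -> itermeas h -> boxed N h ->
  itermeas (fun x => g x - h x) /\ iint (fun x => g x - h x) = iint g - iint h.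
Proof.
elim: m M N g h => // m IH M N g h mg bg mh bh.
have sB r : itermeas (fun x => slice g r x - slice h r x) /\
    iint (fun x => slice g r x - slice h r x) = iint (slice g r) - iint (slice h r).
  exact: IH (mg.1 r) (boxed_slice r bg) (mh.1 r) (boxed_slice r bh).
have sE : (fun r => iint (slice (fun x => g x - h x) r)) =
    (fun r => iint (slice g r) - iint (slice h r)).
  by apply/funext => r; exact: (sB r).2.
split; first split; first by move=> r; exact: (sB r).1.
  by rewrite sE; apply: measurable_funB; [exact: mg.2|exact: mh.2].
rewrite [LHS]/= -RintegralB //; try exact: iint_integrable bg; try exact: iint_integrable bh.
by rewrite -[in LHS]/(\int[mu]_r iint (slice (fun x => g x - h x) r)) sE.
Qed.

(** Dominated convergence at each level, with a multiple of the window indicator as majorant. It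
    also passes iterated measurability to pointwise limits, which is how discontinuous integrands
    are reached. *)
Lemma iint_cvg m M (g_ : nat -> 'rV[R]_m -> R) (g : 'rV[R]_m -> R) :
  (forall k, itermeas (g_ k)) -> (forall k, boxed M (g_ k)) ->
  (forall x, g_ k x @[k --> \oo] --> g x) ->
  itermeas g /\ iint (g_ k) @[k --> \oo] --> iint g.
Proof.
elim: m M g_ g => [|m IH] M g_ g mg bg gg; first by split=> //; exact: gg.
have sc r : itermeas (slice g r) /\
    iint (slice (g_ k) r) @[k --> \oo] --> iint (slice g r).
  apply: (IH (M * \1_window r)) => [k|k|x]; [exact: (mg k).1|exact: boxed_slice|exact: gg].
have mI : measurable_fun setT (fun r => iint (slice g r)).
  by apply: (measurable_fun_cvg (h := fun k r => iint (slice (g_ k) r))) => [k|r _];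
    [exact: (mg k).2|exact: (sc r).2].
split; first by split=> // r; exact: (sc r).1.
have [||||| ig _ dct] := @dominated_convergence _ _ R mu setT measurableT
  (fun k r => (iint (slice (g_ k) r))%:E) (fun r => (iint (slice g r))%:E)
  (fun r => (4 ^+ m * M * \1_window r)%:E).
- by move=> k; apply/measurable_EFinP; exact: (mg k).2.
- exact/measurable_EFinP.
- by apply: aeW => r _; apply: cvg_EFin; [exact: nearW|exact: (sc r).2].
- exact: integrable_window.
- by apply: aeW => r k _; rewrite abse_EFin lee_fin -mulrA; exact: iint_le ((mg k).1 r) (boxed_slice r (bg k)).
have fin : (\int[mu]_r (iint (slice g r))%:E)%E \is a fin_num by exact: integrable_fin_num ig.
by rewrite -(fineK fin) in dct; exact: fine_cvg dct.
Qed.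

Definition cvgv m (u : nat -> 'rV[R]_m) (x : 'rV[R]_m) :=
  forall j, u k ord0 j @[k --> \oo] --> x ord0 j.

(** The sequential form is inherited by slices through [cvgv_row_mx] and feeds directly into
    dominated convergence. *)
Definition seqcont m (F : 'rV[R]_m -> R) :=
  forall u x, cvgv u x -> F (u k) @[k --> \oo] --> F x.

Lemma cvgv_row_mx m (r_ : nat -> R) (y_ : nat -> 'rV[R]_m) r y :
  r_ k @[k --> \oo] --> r -> cvgv y_ y ->
  cvgv (m := m.+1) (fun k => row_mx (const_mx (r_ k) : 'rV[R]_1) (y_ k))
       (row_mx (const_mx r : 'rV[R]_1) y).
Proof.
move=> rr yy j; case: (@split_ordP 1 m j) => i ->.
  by under eq_fun do rewrite (@row_mxEl _ _ 1) mxE; rewrite (@row_mxEl _ _ 1) mxE.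
by under eq_fun do rewrite (@row_mxEr _ _ 1); rewrite (@row_mxEr _ _ 1); exact: yy.
Qed.

(** A bound independent of r, so that slices at varying r fit one constant in [iint_cvg]. *)
Lemma boxed_slice_le m M (g : 'rV[R]_m.+1 -> R) r : boxed M g -> boxed M (slice g r).
Proof.
move=> bg; have [sM s2] := boxed_slice r bg; split=> // x; rewrite (le_trans (sM x)) //.
by rewrite ler_piMr ?(boxed_ge0 bg) // indicE; case: (_ \in _).
Qed.

(** By dominated convergence the inner integral is continuous in the outer variable, hence
    measurable. *)
Lemma itermeas_seqcont m M (g : 'rV[R]_m -> R) : seqcont g -> boxed M g -> itermeas g.
Proof.
elim: m g => // m IH g cg bg.
have mg r : itermeas (slice g r).
  apply: IH (boxed_slice_le r bg) => u x ux; apply: cg.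
  by apply: cvgv_row_mx => //; exact: cvg_cst.
split=> //; apply: continuous_measurable_fun => r.
apply/(@cvg_nbhsP R R^o) => u ur.
apply: (iint_cvg (M := M) (g_ := fun k => slice g (u k)) _ _ _).2 => [k|k|y].
- exact: mg.
- exact: boxed_slice_le.
- by apply: cg; apply: cvgv_row_mx => // j; exact: cvg_cst.
Qed.

End IteratedIntegral.

(** * Spherical integrals and Lipschitz dependence of the Steiner point *)

Section SphereIntegral.
Context {R : realType}.
Set Implicit Arguments.
Unset Strict Implicit.
Implicit Types m : nat.

Lemma cvg_dist_le (F a : nat -> R) (l : R) :
  (forall k, `|F k - l| <= a k) -> a k @[k --> \oo] --> 0 -> F k @[k --> \oo] --> l.
Proof.
move=> Fa a0; apply/cvgrPdist_le => e e0.
have /cvgrPdist_le /(_ _ e0) := a0; apply: filterS => k; rewrite sub0r normrN => ae.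
by rewrite distrC (le_trans (Fa k)) // (le_trans (ler_norm _)).
Qed.

Lemma enorm_seqcont m : seqcont (@enorm R m).
Proof.
move=> u x ux; have : dotv (u k) (u k) @[k --> \oo] --> dotv x x.
  apply: cvg_big => [|j _]; first exact: add_continuous.
  exact: (cvgM (ux j) (ux j)).
by move=> h; apply: (continuous_cvg _ _ h); exact: sqrt_continuous.
Qed.

Lemma enormB_cvg0 m (u : nat -> 'rV[R]_m) x :
  cvgv u x -> enorm (u k - x) @[k --> \oo] --> 0.
Proof.
move=> ux; rewrite -(@enorm0 R m); apply: enorm_seqcont => j.
under eq_fun do rewrite !mxE; rewrite mxE -(subrr (x ord0 j)).
by apply: cvgB; [exact: ux|exact: cvg_cst].
Qed.

Definition clamp (t : R) : R := if t <= 0 then 0 else if 1 <= t then 1 else t.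

Lemma clamp_bounds t : 0 <= clamp t <= 1.
Proof. by rewrite /clamp; case: (lerP t 0) => ?; case: (lerP 1 t) => /= ?; apply/andP; split; lra. Qed.

Lemma clamp_lipschitz s t : `|clamp s - clamp t| <= `|s - t|.
Proof.
rewrite ler_norml /clamp; case: (lerP s 0) => ?; case: (lerP t 0) => ?;
  case: (lerP 1 s) => ?; case: (lerP 1 t) => ?; case: (ger0P (s - t)) => /= ?; apply/andP; split; lra.
Qed.

Lemma clamp_cvg (u : nat -> R) t :
  u k @[k --> \oo] --> t -> clamp (u k) @[k --> \oo] --> clamp t.
Proof.
move=> ut; apply: (cvg_dist_le (fun k => clamp_lipschitz (u k) t)).
rewrite -(normr0 R) -(subrr t); apply: cvg_norm.
by apply: cvgB => //; exact: cvg_cst.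
Qed.

(** At x = 0 the convention 0^-1 = 0 evaluates phi at 0, so bounds on phi are assumed on the whole
    unit ball rather than on the sphere. *)
Definition radial m (phi : 'rV[R]_m -> R) (x : 'rV[R]_m) : R :=
  if enorm x <= 1 then phi ((enorm x)^-1 *: x) else 0.

Lemma enorm_normalize_le m (x : 'rV[R]_m) e : 0 <= e -> enorm ((enorm x + e)^-1 *: x) <= 1.
Proof.
move=> e0; have n0 := enorm_ge0 x; rewrite enormZ ger0_norm ?invr_ge0 ?addr_ge0 //.
have [h|h] := eqVneq (enorm x + e) 0; first by rewrite h invr0 mul0r.
by rewrite mulrC ler_pdivrMr ?mul1r ?lerDl // lt_neqAle eq_sym h addr_ge0.
Qed.

Lemma boxed_radial m M (phi : 'rV[R]_m -> R) :
  0 <= M -> (forall p, enorm p <= 1 -> `|phi p| <= M) -> boxed M (radial phi).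
Proof.
move=> M0 pM; rewrite /radial; split=> x; case: ifP => x1; rewrite ?normr0 ?eqxx //.
  by apply: pM; have := enorm_normalize_le x (lexx 0); rewrite addr0.
by move=> _ j; rewrite (le_trans (coord_le_enorm _ _)) // (le_trans x1) //; lra.
Qed.

(** The integrand may jump at 0 and across |x| = 1. It is a pointwise limit of continuous boxed
    functions: 1/(k+1) regularises the normalisation, and a cutoff of slope k+1 replaces the
    indicator of the ball. *)
Lemma itermeas_radial m M (phi : 'rV[R]_m -> R) :
  seqcont phi -> 0 <= M -> (forall p, enorm p <= 1 -> `|phi p| <= M) ->
  itermeas (radial phi).
Proof.
move=> cphi M0 pM; pose e (k : nat) : R := k.+1%:R^-1.
have e0 k : 0 < e k by rewrite invr_gt0 ltr0n.
pose g k (x : 'rV[R]_m) :=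
  phi ((enorm x + e k)^-1 *: x) * clamp (1 - k.+1%:R * (enorm x - 1)).
have bg k : boxed M (g k).
  split=> x.
    have /andP[c0 c1] := clamp_bounds (1 - k.+1%:R * (enorm x - 1)).
    rewrite normrM (ger0_norm c0) -[leRHS]mulr1 ler_pM // pM //.
    exact: enorm_normalize_le (ltW (e0 k)).
  move=> gx j; rewrite (le_trans (coord_le_enorm _ _)) // leNgt; apply/negP => x2.
  move/eqP: gx; apply; rewrite /g.
  (* The slope is at least 1, so the cutoff is already 0 at norm 2. *)
  have k1 : 1 <= k.+1%:R :> R by rewrite ler1n.
  have -> : clamp (1 - k.+1%:R * (enorm x - 1)) = 0; last by rewrite mulr0.
  have h : 1 - k.+1%:R * (enorm x - 1) <= 0 by nra.
  by rewrite /clamp h.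
apply: (iint_cvg (M := M) (g_ := g) _ bg _).1 => [k|x].
  apply: itermeas_seqcont (bg k) => u x ux; apply: cvgM.
    apply: cphi => j; under eq_fun do rewrite mxE; rewrite mxE; apply: cvgM; last exact: ux.
    apply: cvgV; first by rewrite gt_eqF // ltr_wpDl // enorm_ge0.
    by apply: cvgD; [exact: enorm_seqcont|exact: cvg_cst].
  apply: clamp_cvg; apply: cvgB; first exact: cvg_cst.
  apply: cvgM; first exact: cvg_cst.
  by apply: cvgB; [exact: enorm_seqcont|exact: cvg_cst].
rewrite /radial; case: (leP (enorm x) 1) => x1.
  rewrite (_ : g ^~ x = fun k => phi ((enorm x + e k)^-1 *: x)); last first.
    apply/funext => k; rewrite /g.
    have h : 1 <= 1 - k.+1%:R * (enorm x - 1).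
      by rewrite lerBrDl addrC -lerBrDl subrr mulr_ge0_le0 // subr_le0.
    by rewrite /clamp h leNgt (lt_le_trans ltr01 h) mulr1.
  apply: cphi => j; under eq_fun do rewrite mxE; rewrite mxE.
  (* At the origin every approximant already equals the limit, phi at 0. *)
  have [x0|x0] := eqVneq (enorm x) 0.
    by rewrite (enorm_eq0 x0) mxE mulr0; under eq_fun do rewrite mulr0; exact: cvg_cst.
  apply: cvgM; last exact: cvg_cst.
  apply: cvgV => //; rewrite -[X in _ --> X]addr0; apply: cvgD; first exact: cvg_cst.
  exact: cvg_harmonic.
(* Outside the ball the cutoff vanishes as soon as k >= 1 / (|x| - 1). *)
apply: cvg_near_cst; near=> k.
have h : 1 - k.+1%:R * (enorm x - 1) <= 0.
  rewrite subr_le0 -ler_pdivrMr ?subr_gt0 // mul1r.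
  apply: (@le_trans _ _ k%:R); last by rewrite ler_nat.
  by near: k; exact: nbhs_infty_ger.
by rewrite /g /clamp h mulr0.
Unshelve. all: by end_near. Qed.

Lemma sphere_int_close m M (phi psi : 'rV[R]_m -> R) (eps : R) :
  seqcont phi -> seqcont psi -> 0 <= M -> 0 <= eps ->
  (forall p, enorm p <= 1 -> `|phi p| <= M) -> (forall p, enorm p <= 1 -> `|psi p| <= M) ->
  (forall p, enorm p <= 1 -> `|phi p - psi p| <= eps) ->
  `|sphere_int phi - sphere_int psi| <= 4 ^+ m * eps /
     `|iint (fun x : 'rV[R]_m => if enorm x <= 1 then 1 else 0)|.
Proof.
move=> cphi cpsi M0 eps0 phiM psiM close.
have [mB iB] := iintB (itermeas_radial cphi M0 phiM) (boxed_radial M0 phiM)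
  (itermeas_radial cpsi M0 psiM) (boxed_radial M0 psiM).
rewrite /sphere_int -mulrBl -/(radial phi) -/(radial psi) -iB normrM normfV.
rewrite ler_wpM2r ?invr_ge0 // iint_le //.
rewrite (_ : (fun x => _) = radial (fun p => phi p - psi p)); first exact: boxed_radial.
by apply/funext => x; rewrite /radial; case: ifP; rewrite ?subrr.
Qed.

Lemma seqcont_coord_supportf m (K : set 'rV[R]_m) B j : K !=set0 ->
  (forall y, K y -> enorm y <= B) -> seqcont (fun p => p ord0 j * supportf K p).
Proof.
move=> K0 KB u x ux; apply: cvgM; first exact: ux.
apply: (cvg_dist_le (fun k => supportf_lipschitz (u k) x K0 KB)).
by rewrite -(mulr0 B); apply: cvgM; [exact: cvg_cst|exact: enormB_cvg0].
Qed.

(** Support functions of sets within del of each other differ by at most del on the unit ball, and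
    integration multiplies this by a constant depending on the dimension alone, not on the size B of
    the sets. *)
Lemma steiner_point_close m : exists2 C : R, 0 <= C &
  forall (K L : set 'rV[R]_m) (B del : R), 0 <= del -> K !=set0 -> L !=set0 ->
  (forall y, K y -> enorm y <= B) -> (forall y, L y -> enorm y <= B) ->
  (forall y, K y -> exists2 z, L z & enorm (y - z) <= del) ->
  (forall y, L y -> exists2 z, K z & enorm (y - z) <= del) ->
  forall j, `|steiner_point K ord0 j - steiner_point L ord0 j| <= C * del.
Proof.
pose I : R := `|iint (fun x : 'rV[R]_m => if enorm x <= 1 then 1 else 0 : R)|.
(* The factor m is that of the Steiner formula, 4^m the volume of the box containing the supports,
   and I the normalising ball integral. *)
exists (m%:R * 4 ^+ m / I); first by rewrite divr_ge0 ?normr_ge0 // mulr_ge0 ?ler0n ?exprn_ge0.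
move=> K L B del del0 K0 L0 KB LB KL LK j.
have B0 : 0 <= B by have [y Ky] := K0; rewrite (le_trans (enorm_ge0 y)) // KB.
have bnd (A : set 'rV[R]_m) : A !=set0 -> (forall y, A y -> enorm y <= B) ->
    forall p, enorm p <= 1 -> `|p ord0 j * supportf A p| <= B.
  move=> A0 AB p p1; rewrite normrM -[leRHS]mul1r ler_pM //.
    by rewrite (le_trans (coord_le_enorm _ _)).
  have := supportf_lipschitz p 0 A0 AB; rewrite supportf0 // !subr0 => h.
  by rewrite (le_trans h) // ler_piMr.
have -> : m%:R * 4 ^+ m / I * del = m%:R * (4 ^+ m * del / I).
  by rewrite -!mulrA (mulrC I^-1).
rewrite !mxE -mulrBr normrM normr_nat ler_wpM2l //.
apply: (sphere_int_close (seqcont_coord_supportf (j := j) K0 KB) (seqcont_coord_supportf (j := j) L0 LB)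
  B0 del0 (bnd K K0 KB) (bnd L L0 LB)).
move=> p p1; rewrite -mulrBr normrM -[leRHS]mul1r ler_pM //.
  by rewrite (le_trans (coord_le_enorm _ _)).
rewrite ler_norml; have := supportf_excess K0 L0 LB p1 KL.
have := supportf_excess L0 K0 KB p1 LK; lra.
Qed.

End SphereIntegral.

(** * Stability of the Steiner point of the truncated epigraph *)

Section Stability.
Context {R : realType}.
Set Implicit Arguments.
Unset Strict Implicit.
Implicit Types n : nat.

Definition truncated_epiconj n (h : 'rV[R]_n -> R) (a : 'rV[R]_(n + 1)) :=
  epiconj h `&` cball a (2 * Defs.edist a (epiconj h)).

Lemma PhiSetE n (H : R -> 'rV[R]_n -> 'rV[R]_n -> R) t x a :
  PhiSet H t x a = truncated_epiconj (H t x) a.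
Proof. by rewrite /PhiSet epiHconjE. Qed.

Lemma edist_epiconj_le n (h : 'rV[R]_n -> R) (a : 'rV[R]_(n + 1)) (M A : R) :
  convexfun h -> continuous h -> (forall q, enorm q <= 1 -> `|h q| <= M) -> enorm a <= A ->
  Defs.edist a (epiconj h) <= A + (3 * M + 2).
Proof.
move=> ch hh hM aA; have [z zE zM] := epiconj_bounded_point ch hh hM.
have [w Ew wmin] := nearest_point a (closed_epiconj (h:=h)) (ex_intro _ _ zE).
rewrite (edist_nearest Ew wmin) (le_trans (wmin z zE)) //.
by rewrite (le_trans (enormD _ _)) // enormN lerD.
Qed.

Lemma truncated_epiconj_neq0 n (h : 'rV[R]_n -> R) (a : 'rV[R]_(n + 1)) :
  convexfun h -> continuous h -> truncated_epiconj h a !=set0.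
Proof.
move=> ch hh; have [z zE _] := affine_minorant 0 ch hh ltr01.
have [w Ew wmin] := nearest_point a (closed_epiconj (h:=h)) (ex_intro _ _ zE).
exists w; split=> //; rewrite /cball /= (edist_nearest Ew wmin).
by have := enorm_ge0 (a - w); lra.
Qed.

(** Chains the excess estimates for epigraphs and truncations with the Lipschitz bound for Steiner
    points. P and gam depend only on n, A, M and eps, so they serve all h, k and a at once. *)
Lemma steiner_point_stable n (A M eps : R) : 0 <= A -> 0 <= M -> 0 < eps ->
  exists P gam : R, [/\ 0 < P, 0 < gam &
    forall h k : 'rV[R]_n -> R,
    convexfun h -> continuous h -> convexfun k -> continuous k ->
    (forall q, enorm q <= 1 -> `|h q| <= M) -> (forall q, enorm q <= 1 -> `|k q| <= M) ->
    (forall q, enorm q <= P -> `|h q - k q| <= gam) ->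
    forall a, enorm a <= A -> forall j,
    `|steiner_point (truncated_epiconj h a) ord0 j -
      steiner_point (truncated_epiconj k a) ord0 j| <= eps].
Proof.
move=> A0 M0 eps0; have [C C0 close] := @steiner_point_close R (n + 1).
(* D bounds the distance from a to either epigraph, so both truncations lie in the ball of radius
   rho about 0. *)
pose D := A + (3 * M + 2); pose rho := A + 2 * D.
(* The 10 is the loss in the truncation; C + 1 replaces C, which may be 0. *)
pose del := eps / (10 * (C + 1)).
have del0 : 0 < del by rewrite divr_gt0 //; lra.
have delE : 10 * (C + 1) * del = eps by rewrite /del; field; rewrite gt_eqF //; lra.
have D0 : 0 <= D by rewrite /D; lra.
have [|P [gam [P0 gam0 exc]]] := @epiconj_excess R n M rho del M0 _ del0.
  by rewrite /rho; lra.
exists P, gam; split=> // h k ch hc ck kc hM kM hk a aA j.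
have kh q : enorm q <= P -> `|k q - h q| <= gam by move=> /hk; rewrite distrC.
have at0 (g : 'rV[R]_n -> R) : (forall q, enorm q <= 1 -> `|g q| <= M) -> g 0 <= M.
  by move=> gM; rewrite (le_trans (ler_norm _)) // gM // enorm0 ler01.
have ne (g : 'rV[R]_n -> R) : convexfun g -> continuous g -> epiconj g !=set0.
  by move=> cg gc; have [z zE _] := affine_minorant 0 cg gc ltr01; exists z.
have rhoD : enorm a + 2 * D <= rho by rewrite /rho lerD2r.
have dh := edist_epiconj_le ch hc hM aA.
have dk := edist_epiconj_le ck kc kM aA.
have bnd (g : 'rV[R]_n -> R) : Defs.edist a (epiconj g) <= D ->
    forall y, truncated_epiconj g a y -> enorm y <= rho.
  move=> dg y [_ /=]; rewrite /cball /= => yb.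
  have -> : y = a - (a - y) by rewrite opprB addrC subrK.
  rewrite (le_trans (enormD _ _)) // enormN (le_trans _ rhoD) // lerD2l (le_trans yb) //.
  by rewrite ler_pM2l.
have hk' := exc h k ck kc (at0 k kM) hk.
have kh' := exc k h ch hc (at0 h hM) kh.
have Ceps : C * (10 * del) <= eps by rewrite -delE; lra.
apply: le_trans Ceps.
have del10 : 0 <= 10 * del by lra.
apply: (close _ _ rho) => //.
- exact: truncated_epiconj_neq0.
- exact: truncated_epiconj_neq0.
- exact: bnd.
- exact: bnd.
- move=> y [yE yb]; apply: (truncation_excess _ _ _ _ _ del0 dk dh rhoD kh' hk' yE yb);
    first [exact: convex_epiconj|exact: closed_epiconj|exact: ne].
- move=> y [yE yb]; apply: (truncation_excess _ _ _ _ _ del0 dh dk rhoD hk' kh' yE yb);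
    first [exact: convex_epiconj|exact: closed_epiconj|exact: ne].
Qed.

(** * Compactness and uniform convergence *)

Lemma continuous_pairing (S U V : topologicalType) (f : S -> U) (g : S -> V) :
  continuous f -> continuous g -> continuous (fun s => (f s, g s)).
Proof.
move=> cf cg s.
exact: (@cvg_pair _ _ _ (nbhs s) (nbhs (f s)) (nbhs (g s)) _ _ _ f g (cf s) (cg s)).
Qed.

Lemma Hyp_slice n (T : R) (H : R -> 'rV[R]_n -> 'rV[R]_n -> R) t x :
  Hyp T H -> t \in `[0, T] -> convexfun (H t x) /\ continuous (H t x).
Proof.
move=> [_ [_ [h2 [h3 _]]]] tT; split; first by move=> p q l; exact: h3.
move=> p; apply: (@continuous_comp _ _ _ (fun p : 'rV[R]_n => (x, p))
  (fun xp : 'rV[R]_n * 'rV[R]_n => H t xp.1 xp.2)); last exact: h2.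
exact: (@continuous_pairing _ _ _ (fun=> x) id (@cst_continuous _ _ x) (fun=> cvg_id)).
Qed.

(** Convergence is assumed on compact sets of (t, x, p) but claimed on compact sets of (t, x, a).
    This trades a for a ball of momenta p, as the image of a compact product under a continuous
    map. *)
Lemma compact_phase n (K : set (R * ('rV[R]_n * 'rV[R]_(n + 1)))) (P : R) : compact K ->
  compact [set q : R * ('rV[R]_n * 'rV[R]_n) |
    exists2 s, K s & q.1 = s.1 /\ q.2.1 = s.2.1 /\ enorm q.2.2 <= P].
Proof.
move=> cK.
pose f (sp : (R * ('rV[R]_n * 'rV[R]_(n + 1))) * 'rV[R]_n) := (sp.1.1, (sp.1.2.1, sp.2)).
rewrite (_ : [set _ | _] = f @` (K `*` cball 0 P)).
  apply: continuous_compact; last exact: compact_setX cK (@compact_cball R n 0 P).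
  have cfst (U V : topologicalType) : continuous (@fst U V).
    by move=> uv; exact: (@cvg_fst _ _ (nbhs uv.1) (nbhs uv.2)).
  have csnd (U V : topologicalType) : continuous (@snd U V).
    by move=> uv; exact: (@cvg_snd _ _ (nbhs uv.1) (nbhs uv.2)).
  apply: continuous_subspaceT; apply: continuous_pairing.
    by move=> sp; exact: (continuous_comp (cfst _ _ sp) (cfst _ _ _)).
  apply: continuous_pairing; last exact: csnd.
  have c12 : continuous (fun sp : (R * ('rV[R]_n * 'rV[R]_(n + 1))) * 'rV[R]_n => sp.1.2).
    by move=> sp; exact: (continuous_comp (cfst _ _ sp) (csnd _ _ _)).
  by move=> sp; exact: (continuous_comp (c12 sp) (cfst _ _ _)).
apply/seteqP; split=> [[t [x p]] /= [s Ks [-> [-> pP]]]|_ [[s p] [/= Ks pP] <-]].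
  by exists (s, p) => //; split=> //=; rewrite /cball /= add0r enormN.
by exists s => //; move: pP; rewrite /cball /= add0r enormN.
Qed.

Lemma steiner_e_cvg n (T : R) (Hs : nat -> R -> 'rV[R]_n -> 'rV[R]_n -> R)
    (H : R -> 'rV[R]_n -> 'rV[R]_n -> R) (K : set (R * ('rV[R]_n * 'rV[R]_(n + 1)))) (eps : R) :
  (forall i, Hyp T (Hs i)) -> Hyp T H ->
  unif_cvg_compact [set q : R * ('rV[R]_n * 'rV[R]_n) | q.1 \in `[0, T]]
    (fun i (q : R * ('rV[R]_n * 'rV[R]_n)) => Hs i q.1 q.2.1 q.2.2)
    (fun q : R * ('rV[R]_n * 'rV[R]_n) => H q.1 q.2.1 q.2.2) ->
  compact K -> K `<=` [set q | q.1 \in `[0, T]] -> 0 < eps ->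
  exists N : nat, forall i, (N <= i)%N -> forall q, K q -> forall j,
    `|steiner_e (Hs i) q.1 q.2.1 q.2.2 ord0 j - steiner_e H q.1 q.2.1 q.2.2 ord0 j| <= eps.
Proof.
move=> hHs hH cvgH cK KT eps0.
pose Q P := [set q : R * ('rV[R]_n * 'rV[R]_n) |
    exists2 s, K s & q.1 = s.1 /\ q.2.1 = s.2.1 /\ enorm q.2.2 <= P].
have cQ P : compact (Q P) by exact: compact_phase.
have QT P : Q P `<=` [set q | q.1 \in `[0, T]].
  by move=> q [s Ks [qs _]] /=; rewrite qs; exact: KT.
have [A A0 KA] : exists2 A : R, 0 <= A & forall q, K q -> enorm q.2.2 <= A.
  have [A [_ hA]] := compact_bounded cK.
  exists ((n + 1)%:R * (`|A| + 1)); first by rewrite mulr_ge0 // addr_ge0.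
  move=> q Kq; rewrite (le_trans (enorm_le_normr _)) // ler_wpM2l //.
  have Alt : A < `|A| + 1 by rewrite (le_lt_trans (ler_norm _)) // ltrDl.
  have /= := hA _ Alt q Kq; rewrite prod_normE ge_max => /andP[_].
  by rewrite prod_normE ge_max => /andP[].
have [M M0 HM] : exists2 M : R, 0 <= M & forall q, Q 1 q -> `|H q.1 q.2.1 q.2.2| <= M.
  have cH : {within Q 1, continuous (fun q : R * ('rV[R]_n * 'rV[R]_n) => H q.1 q.2.1 q.2.2)}.
    exact: continuous_subspaceW (QT 1) hH.1.
  have [M [_ hM]] := compact_bounded (continuous_compact cH (cQ 1)).
  exists (`|M| + 1); first by rewrite addr_ge0.
  move=> q Qq; apply: hM; last by exists q.
  by rewrite (le_lt_trans (ler_norm _)) // ltrDl.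
(* Tolerance 1 on Q 1 gives the common bound M + 1 for H and the late [Hs i]; it has to be fixed
   before P and gam are chosen. *)
have [N1 hN1] := cvgH _ (cQ 1) (QT 1) 1 ltr01.
have [P [gam [P0 gam0 stable]]] := @steiner_point_stable n A (M + 1) eps A0 (addr_ge0 M0 ler01) eps0.
have [N2 hN2] := cvgH _ (cQ P) (QT P) gam gam0.
exists (maxn N1 N2) => i; rewrite geq_max => /andP[iN1 iN2] [t [x a]] Kq j /=.
have tT : t \in `[0, T] := KT _ Kq.
have [ch hc] := Hyp_slice x hH tT.
have [chi hci] := Hyp_slice x (hHs i) tT.
have inQ P' p : enorm p <= P' -> Q P' (t, (x, p)) by move=> pP; exists (t, (x, a)).
rewrite /steiner_e !PhiSetE; apply: stable (KA _ Kq) j => //.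
- move=> p p1; have := hN1 i iN1 _ (inQ 1 p p1); have := HM _ (inQ 1 p p1) => /= h1 h2.
  rewrite -[Hs i t x p](subrK (H t x p)) (le_trans (ler_normD _ _)) // addrC lerD //.
  exact: ltW.
- by move=> p p1; rewrite (le_trans (HM _ (inQ 1 p p1))) // lerDl.
- by move=> p pP; exact: ltW (hN2 i iN2 _ (inQ P p pP)).
Qed.

Lemma normr_rV_lt m (u : 'rV[R]_m) e : 0 < e -> (forall j, `|u ord0 j| < e) -> `|u| < e.
Proof.
move=> e0 ue; rewrite [ltLHS]/Num.Def.normr /= mx_normrE.
by apply/bigmax_ltP; split=> // -[i j] _ /=; rewrite ord1.
Qed.

End Stability.

Theorem theorem4p2 (R : realType) (n : nat) (T : R)
    (Hs : nat -> R -> 'rV[R]_n -> 'rV[R]_n -> R)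
    (H : R -> 'rV[R]_n -> 'rV[R]_n -> R) :
  (forall i, Hyp T (Hs i)) -> Hyp T H ->
  unif_cvg_compact [set q : R * ('rV[R]_n * 'rV[R]_n) | q.1 \in `[0, T]]
    (fun i (q : R * ('rV[R]_n * 'rV[R]_n)) => Hs i q.1 q.2.1 q.2.2)
    (fun q : R * ('rV[R]_n * 'rV[R]_n) => H q.1 q.2.1 q.2.2) ->
  unif_cvg_compact [set q : R * ('rV[R]_n * 'rV[R]_(n + 1)) | q.1 \in `[0, T]]
    (fun i (q : R * ('rV[R]_n * 'rV[R]_(n + 1))) => steiner_f (Hs i) q.1 q.2.1 q.2.2)
    (fun q : R * ('rV[R]_n * 'rV[R]_(n + 1)) => steiner_f H q.1 q.2.1 q.2.2)
  /\
  unif_cvg_compact [set q : R * ('rV[R]_n * 'rV[R]_(n + 1)) | q.1 \in `[0, T]]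
    (fun i (q : R * ('rV[R]_n * 'rV[R]_(n + 1))) => steiner_l (Hs i) q.1 q.2.1 q.2.2)
    (fun q : R * ('rV[R]_n * 'rV[R]_(n + 1)) => steiner_l H q.1 q.2.1 q.2.2).
Proof.
move=> hHs hH cvgH; split=> K cK KT eps eps0;
  (* Halving eps turns the non-strict coordinate bound into the strict one required. *)
  have eps2 : 0 < eps / 2 by [rewrite divr_gt0];
  have [N hN] := steiner_e_cvg hHs hH cvgH cK KT eps2;
  exists N => i iN q Kq; have := hN i iN q Kq => close.
  apply: normr_rV_lt => // j.
  by have := close (lshift 1 j); rewrite !mxE => /le_lt_trans; apply; lra.
rewrite /steiner_l /etapart.
by have := close (rshift n ord0); rewrite !mxE => /le_lt_trans; apply; lra.
Qed.
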